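(* Let $f:(0,\infty)\to\mathbb{R}$ be smooth and let $g=e^{2f(r)}(-dt^2+dr^2+dz^2)+r^2e^{-2f(r)}d\phi^2$ on $M=\{(t,r,z)\in\mathbb{R}^3:r>0\}\times S^1$, with $\phi$ the angular coordinate on $S^1$. If $rf''+rf'^2-f'=0$, then $$R\cdot R=\mathcal{L}_R\,Q(g,R),\qquad \mathcal{L}_R=\frac{e^{-2f}}{r}\,(f'-rf'^2).$$
   Context: Primes denote derivatives with respect to $r$. Conventions: with $\nabla$ the Levi-Civita connection, the curvature endomorphism is $\mathcal{R}(U,V)=\nabla_{[U,V]}-[\nabla_U,\nabla_V]$ and $R(Z_1,Z_2,Z_3,Z_4)=g(\mathcal{R}(Z_1,Z_2)Z_3,Z_4)$. For a $(0,4)$-tensor $A$ with associated endomorphism $\mathcal{A}(U,V)$ given by $g(\mathcal{A}(U,V)Z_1,Z_2)=A(U,V,Z_1,Z_2)$, a symmetric $(0,2)$-tensor $B$ and a $(0,k)$-tensor $T$: $(A\cdot T)(Z_1,\dots,Z_k;U,V)=-\sum_{i}T(Z_1,\dots,\mathcal{A}(U,V)Z_i,\dots,Z_k)$ and $Q(B,T)(Z_1,\dots,Z_k;U,V)=-\sum_{i}T(Z_1,\dots,(U\wedge_BV)Z_i,\dots,Z_k)$, where $(U\wedge_BV)Z=B(V,Z)U-B(U,Z)V$. *)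

(* Defs.v *)
From HB Require Import structures.
From mathcomp Require Import all_boot all_order all_algebra.
From mathcomp Require Import all_classical all_reals all_analysis.

Set Implicit Arguments.
Unset Strict Implicit.
Unset Printing Implicit Defensive.

Import Order.TTheory GRing.Theory Num.Theory.
Import numFieldNormedType.Exports.

Local Open Scope classical_set_scope.
Local Open Scope ring_scope.

(* Coordinates are ordered (t, r, z, phi). *)
Definition it : 'I_4 := @Ordinal 4 0 isT.
Definition ir : 'I_4 := @Ordinal 4 1 isT.
Definition iz : 'I_4 := @Ordinal 4 2 isT.
Definition iphi : 'I_4 := @Ordinal 4 3 isT.

(* The manifold M = {(t, r, z) | r > 0} x S^1, with S^1 = R / 2 pi Z, is
   handled through its universal cover {(t, r, z, phi) | r > 0} in R^4:
   functions and vector fields on M are functions and vector fields on the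
   cover that are 2 pi-periodic in phi.  The coordinate frame
   (d_t, d_r, d_z, d_phi) is global on M, so a vector field is given by the row
   of its components.  Values at points outside [ucover] are irrelevant. *)
Section Manifold.
Variable R : realType.

Definition coords := 'rV[R]_4.
Definition ucover : set coords := [set p | 0 < p 0 ir].

Definition eq_on_ucover (W : Type) (F G : coords -> W) : Prop :=
  forall p, ucover p -> F p = G p.

Section Smooth.
Variable W : normedModType R.

Definition partial (i : 'I_4) (F : coords -> W) : coords -> W :=
  fun p => 'D_(delta_mx 0 i) F p.

Definition iter_partial (s : seq 'I_4) (F : coords -> W) : coords -> W :=
  foldr partial F s.

Definition periodic (F : coords -> W) : Prop :=
  eq_on_ucover (fun p => F (p + (2 * pi) *: delta_mx 0 iphi)) F.

(* C^infty functions on M *)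
Definition smooth (F : coords -> W) : Prop :=
  (forall (s : seq 'I_4) (p : coords), ucover p ->
     differentiable (iter_partial s F) p) /\ periodic F.

End Smooth.

Definition scalar_field := coords -> R.
Definition vfield := coords -> 'rV[R]_4.

(* X(F), for a scalar function F, or componentwise for a row of functions *)
Definition lie_deriv (W : normedModType R) (X : vfield) (F : coords -> W) :
  coords -> W := fun p => 'D_(X p) F p.

Definition bracket (X Y : vfield) : vfield :=
  fun p => lie_deriv X Y p - lie_deriv Y X p.

Definition fscale (a : scalar_field) (X : vfield) : vfield :=
  fun p => a p *: X p.

Definition metric_field := coords -> 'M[R]_4.

(* g(X, Y) *)
Definition inner (g : metric_field) (X Y : vfield) : scalar_field :=
  fun p => (X p *m g p *m (Y p)^T) 0 0.

Record affine_connection (nabla : vfield -> vfield -> vfield) : Prop := {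
  conn_smooth : forall X Y, smooth X -> smooth Y -> smooth (nabla X Y);
  conn_addl : forall X X' Y, smooth X -> smooth X' -> smooth Y ->
    eq_on_ucover (nabla (X \+ X') Y) (nabla X Y \+ nabla X' Y);
  conn_scalel : forall (a : scalar_field) X Y, smooth a -> smooth X -> smooth Y ->
    eq_on_ucover (nabla (fscale a X) Y) (fscale a (nabla X Y));
  conn_addr : forall X Y Y', smooth X -> smooth Y -> smooth Y' ->
    eq_on_ucover (nabla X (Y \+ Y')) (nabla X Y \+ nabla X Y');
  conn_leibniz : forall (a : scalar_field) X Y, smooth a -> smooth X -> smooth Y ->
    eq_on_ucover (nabla X (fscale a Y))
                (fscale (lie_deriv X a) Y \+ fscale a (nabla X Y))
}.

Record levi_civita (g : metric_field) (nabla : vfield -> vfield -> vfield) : Prop := {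
  lc_connection : affine_connection nabla;
  lc_torsion_free : forall X Y, smooth X -> smooth Y ->
    eq_on_ucover (fun p => nabla X Y p - nabla Y X p) (bracket X Y);
  lc_metric : forall X Y Z, smooth X -> smooth Y -> smooth Z ->
    eq_on_ucover (lie_deriv X (inner g Y Z))
                (inner g (nabla X Y) Z \+ inner g Y (nabla X Z))
}.

(* Sign convention: R(U,V) = nabla_[U,V] - [nabla_U, nabla_V] *)
Definition curv_endo (nabla : vfield -> vfield -> vfield) (U V : vfield) :
  vfield -> vfield :=
  fun Z p => nabla (bracket U V) Z p
             - (nabla U (nabla V Z) p - nabla V (nabla U Z) p).

Definition tensor (k : nat) := ('I_k -> vfield) -> scalar_field.

(* The slots Z_1, ..., Z_4 are indexed by 0, ..., 3. *)
Definition curv_tensor (g : metric_field) (nabla : vfield -> vfield -> vfield) :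
  tensor 4 :=
  fun Z => inner g (curv_endo nabla (Z 0) (Z 1) (Z 2)) (Z 3).

(* (Z_1, ..., Z_k) |-> - \sum_i T(Z_1, ..., E Z_i, ..., Z_k) *)
Definition endo_act (E : vfield -> vfield) (k : nat) (T : tensor k) :
  tensor k :=
  fun Z p => - \sum_(i < k) T (fun j => if j == i then E (Z j) else Z j) p.

(* (A . T)(Z_1, ..., Z_k; U, V), given the endomorphism cA(U,V) associated
   with A.  For A = [curv_tensor g nabla] that endomorphism is
   [curv_endo nabla], by definition of [curv_tensor]. *)
Definition tensor_dot (cA : vfield -> vfield -> vfield -> vfield)
  (k : nat) (T : tensor k) (Z : 'I_k -> vfield) (U V : vfield) : scalar_field :=
  endo_act (cA U V) T Z.

(* (U /\_B V) Z = B(V,Z) U - B(U,Z) V *)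
Definition wedge_endo (B : vfield -> vfield -> scalar_field) (U V Z : vfield) : vfield :=
  fun p => B V Z p *: U p - B U Z p *: V p.

(* Q(B,T)(Z_1, ..., Z_k; U, V) *)
Definition tachibana (B : vfield -> vfield -> scalar_field)
  (k : nat) (T : tensor k) (Z : 'I_k -> vfield) (U V : vfield) : scalar_field :=
  endo_act (wedge_endo B U V) T Z.

(* e^(2f(r)) (- dt^2 + dr^2 + dz^2) + r^2 e^(-2f(r)) dphi^2 *)
Definition metric_of (f : R -> R) : metric_field := fun p =>
  let r := p 0 ir in
  diag_mx (\row_(i < 4) [:: - expR (2 * f r);
                            expR (2 * f r);
                            expR (2 * f r);
                            r ^+ 2 * expR (- (2 * f r))]`_i).

End Manifold.

(* Main.v *)
(* Let h_n(r) be the diagonal entries of the metric and b_n = h_n' / (2 h_n).  In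
   the coordinate frame the curvature is R(E_i, E_j) E_k =
   kappa_ij (g_jk E_i - g_ik E_j), with kappa_ij a function of r.  The
   differential equation f'' = f'/r - f'^2 makes kappa_ij equal to L for every
   pair except {t, z} and {r, phi}.  Hence R(U, V) - L (U /\_g V) is an
   infinitesimal rotation of the (t, z)-plane plus one of the (r, phi)-plane;
   since all pairs across these two planes share the same kappa = L, such
   rotations annihilate R. *)
Require Import Defs.
From HB Require Import structures.
From mathcomp Require Import all_boot all_order all_algebra.
From mathcomp Require Import all_classical all_reals all_analysis.
From mathcomp Require Import ring lra.
Import Order.TTheory GRing.Theory Num.Theory.
Import numFieldNormedType.Exports.
Local Open Scope classical_set_scope.
Local Open Scope ring_scope.

Set Implicit Arguments.
Unset Strict Implicit.
Unset Printing Implicit Defensive.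

(** * Symmetry of second derivatives *)

(** The connection is an arbitrary operator, known only through axioms about smooth fields and their
    values over [ucover], so nothing pointwise is available at the start. Most of the work goes into
    showing that the curvature at a point depends only on the values of its arguments there:
    derivatives of the components of [U] and [V] cancel against the bracket term, and those of [Z]
    cancel by symmetry of second derivatives. What remains is polynomial algebra on vectors of R^4,
    in which the two exceptional values of kappa stay free parameters; the differential equation
    enters only when the other four are evaluated. *)

Section Schwarz.
Context {R : realType} {V : normedModType R}.

Lemma is_derive_line (F : V -> R) (p u : V) (s : R) :
  derivable F (s *: u + p) u ->
  is_derive s 1 (fun x : R => F (x *: u + p)) ('D_u F (s *: u + p)).
Proof.
have E : (fun h : R => h^-1 *: (((fun x : R => F (x *: u + p)) \o shift s) (h *: 1) -
    F (s *: u + p))) = (fun h : R => h^-1 *: ((F \o shift (s *: u + p)) (h *: u) -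
    F (s *: u + p))).
  apply/funext => h /=; congr (_ *: (F _ - _)).
  by rewrite [h *: 1]mulr1 scalerDl addrA.
by move=> dF; split; rewrite /derivable /derive E.
Qed.

(* The mean value theorem along [u], applied to
   [s |-> F (p + s u + t v) - F (p + s u)], reduces the second difference, which
   is symmetric in [u] and [v], to an increment of ['D_u F]. *)
Lemma second_difference_approx (F : V -> R) (p u v : V) :
  (\forall q \near p, derivable F q u) ->
  differentiable ('D_u F) p ->
  forall e : R, 0 < e -> \forall t \near (0 : R)^'+,
    `|F (t *: u + t *: v + p) - F (t *: u + p) - F (t *: v + p) + F p
      - t ^+ 2 * 'D_v ('D_u F) p| <= e * t ^+ 2.
Proof.
move=> dF dG e e0.
(* Each of the two first-order expansions of [G] used below has error at most e / M * t * (|u| +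
   |v|), so together they stay below e * t; the [+ 1] keeps [M] positive when [u] and [v] vanish. *)
set G := 'D_u F; set M := 2 * (`|u| + `|v|) + 1.
have M0 : 0 < M by rewrite /M; have := normr_ge0 u; have := normr_ge0 v; lra.
have /diff_locally/eqaddoP /(_ (e / M) (divr_gt0 e0 M0)) Gp := dG.
have dF0 : \forall h \near (0 : V), derivable F (h + p) u.
  by move: dF; rewrite (near_shift 0 p) /= subr0.
have [/= d /= d0 dP] : exists2 d : R, 0 < d & forall h : V, `|h| < d ->
    derivable F (h + p) u /\ `|G (h + p) - G p - 'd G p h| <= e / M * `|h|.
  have /nbhs_norm0P [d /= d0 dP] : \forall h \near (0 : V), derivable F (h + p) u /\
      `|G (h + p) - G p - 'd G p h| <= e / M * `|h|.
    near=> h; split; first by near: h.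
    rewrite -addrA -opprD; near: h; exact: Gp.
  by exists d => // h hd; apply: dP; rewrite /= ?sub0r ?normrN.
near=> t.
have t0 : 0 < t by near: t; exact: nbhs_right_gt.
have tM : t * M < d.
  by rewrite -ltr_pdivlMr //; near: t; apply: nbhs_right_lt; rewrite divr_gt0.
have bd (s c : R) : 0 <= s <= t -> 0 <= c <= t ->
    `|s *: u + c *: v| <= t * (`|u| + `|v|).
  move=> /andP[s0 st] /andP[c0 ct]; rewrite (le_trans (ler_normD _ _)) //.
  by rewrite !normrZ !ger0_norm // mulrDr lerD // ler_wpM2r.
have small (s c : R) : 0 <= s <= t -> 0 <= c <= t -> `|s *: u + c *: v| < d.
  move=> hs hc; apply: le_lt_trans tM; apply: le_trans (bd _ _ hs hc) _.
  by rewrite ler_pM2l // /M; have := normr_ge0 u; have := normr_ge0 v; lra.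
have tt : 0 <= t <= t by rewrite lexx ltW.
have z0 : 0 <= (0 : R) <= t by rewrite lexx ltW.
pose phi (c s : R) := F (s *: u + (c *: v + p)).
have dphi (c s : R) : 0 <= c <= t -> 0 <= s <= t ->
    is_derive s 1 (phi c) (G (s *: u + (c *: v + p))).
  move=> hc hs; apply: is_derive_line.
  by have [+ _] := dP _ (small _ _ hs hc); rewrite addrA.
have [xi xit Exi] : exists2 xi, xi \in `]0, t[%R &
    (phi t - phi 0) t - (phi t - phi 0) 0 =
    (G (xi *: u + (t *: v + p)) - G (xi *: u + (0 *: v + p))) * (t - 0).
  apply: (@MVT R (phi t - phi 0)
    (fun s => G (s *: u + (t *: v + p)) - G (s *: u + (0 *: v + p)))) => //.
    move=> x; rewrite in_itv /= => /andP[x0 xt].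
    by apply: is_deriveB; apply: dphi => //; rewrite !ltW.
  apply: derivable_within_continuous => x; rewrite in_itv /= => xt.
  by apply: derivableB; apply: ex_derive; exact: dphi.
have hxi : 0 <= xi <= t by move: xit; rewrite in_itv /= => /andP[? ?]; rewrite !ltW.
have [_ e1] := dP _ (small _ _ hxi tt).
have [_ e2] := dP _ (small _ _ hxi z0).
have b1 := bd _ _ hxi tt; have b2 := bd _ _ hxi z0.
have d1 : 'd G p (xi *: u + t *: v) = xi * 'd G p u + t * 'd G p v.
  by rewrite linearD !linearZ.
have d2 : 'd G p (xi *: u + 0 *: v) = xi * 'd G p u.
  by rewrite scale0r addr0 linearZ.
rewrite deriveE //.
set D1 := G (xi *: u + t *: v + p) - G p - _ in e1.
set D2 := G (xi *: u + 0 *: v + p) - G p - _ in e2.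
have -> : F (t *: u + t *: v + p) - F (t *: u + p) - F (t *: v + p) + F p =
    (D1 - D2 + t * 'd G p v) * t.
  transitivity ((phi t - phi 0) t - (phi t - phi 0) 0).
    rewrite [(phi t - phi 0) t]/(phi t t - phi 0 t) [(phi t - phi 0) 0]/(phi t 0 - phi 0 0).
    by rewrite /phi !scale0r !add0r -addrA opprD opprK !addrA.
  by rewrite Exi subr0 /D1 /D2 d1 d2 !addrA; congr (_ * _); ring.
have -> : (D1 - D2 + t * 'd G p v) * t - t ^+ 2 * 'd G p v = (D1 - D2) * t by ring.
rewrite normrM (gtr0_norm t0) expr2 mulrA ler_pM2r //.
apply: le_trans (ler_normB _ _) _.
have eM0 : 0 <= e / M by rewrite divr_ge0 // ltW.
apply: le_trans (lerD (le_trans e1 (ler_wpM2l eM0 b1)) (le_trans e2 (ler_wpM2l eM0 b2))) _.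
rewrite -mulrDr -(ler_pM2r M0) mulrAC divfK ?gt_eqF // -mulrDr -!mulrA ler_pM2l //.
by rewrite ler_pM2l // /M; lra.
Unshelve. all: by end_near. Qed.

(** One and the same second difference, divided by t^2, tends to both mixed derivatives. The
    argument rests on differentiability of the first derivatives at the single point [p]. *)
Lemma derive_comm (F : V -> R) (p u v : V) :
  (\forall q \near p, derivable F q u) ->
  (\forall q \near p, derivable F q v) ->
  differentiable ('D_u F) p -> differentiable ('D_v F) p ->
  'D_u ('D_v F) p = 'D_v ('D_u F) p.
Proof.
move=> Fu Fv dFu dFv; apply/eqP/negPn/negP => neq.
set a := 'D_u _ p in neq *; set b := 'D_v _ p in neq *.
(* A quarter for each of the two approximations: the errors add up to half of |a - b| t^2, which
   cannot bridge the gap between [a] and [b]. *)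
have e0 : 0 < `|a - b| / 4 by rewrite divr_gt0 // normr_gt0 subr_eq0.
have Au := second_difference_approx v Fu dFu e0.
have Av := second_difference_approx u Fv dFv e0.
rewrite -/b in Au; rewrite -/a in Av; clearbody a b.
suff : \forall t \near (0 : R)^'+, False by move/filter_ex => [].
near=> t.
have t0 : 0 < t by near: t; exact: nbhs_right_gt.
have Xb : `|F (t *: u + t *: v + p) - F (t *: u + p) - F (t *: v + p) + F p
    - t ^+ 2 * b| <= `|a - b| / 4 * t ^+ 2 by near: t.
have Xa : `|F (t *: v + t *: u + p) - F (t *: v + p) - F (t *: u + p) + F p
    - t ^+ 2 * a| <= `|a - b| / 4 * t ^+ 2 by near: t.
set X := F (t *: u + t *: v + p) - F (t *: u + p) - F (t *: v + p) + F p.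
have XE : F (t *: v + t *: u + p) - F (t *: v + p) - F (t *: u + p) + F p = X.
  by rewrite /X (addrC (t *: v)); congr (_ + _); rewrite addrAC.
rewrite -/X in Xb; rewrite XE in Xa.
have : `|a - b| * t ^+ 2 <= `|a - b| / 2 * t ^+ 2.
  have t20 : 0 < t ^+ 2 by rewrite exprn_gt0.
  rewrite -{1}(gtr0_norm t20) -normrM.
  have -> : (a - b) * t ^+ 2 = (X - t ^+ 2 * b) - (X - t ^+ 2 * a) by ring.
  by apply: le_trans (ler_normB _ _) _; lra.
rewrite ler_pM2r ?exprn_gt0 //.
have : 0 < `|a - b| by rewrite normr_gt0 subr_eq0.
lra.
Unshelve. all: by end_near. Qed.
End Schwarz.

(** * Smooth functions on the cover *)

Lemma near_eq_differentiable (R : numFieldType) (V W : normedModType R)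
    (f g : V -> W) (x : V) :
  {near x, f =1 g} -> differentiable f x -> differentiable g x.
Proof.
move=> fg df; have [dfc dfx] := (diff_locallyP _ _).1 df.
have dgx : g \o shift x = cst (g x) + 'd f x +o_ 0 id.
  apply/eqaddoP => e e0; have /eqaddoP/(_ e e0) := dfx.
  rewrite (near_shift 0 x) /= subr0 in fg.
  have fgx : f x = g x by have := nbhs_singleton fg; rewrite /= add0r.
  move=> dfe; near=> h; rewrite /= -fgx.
  have fgh : f (h + x) = g (h + x) by near: h.
  have : `|(f \o shift x - (cst (f x) + 'd f x)) h| <= e * `|h| by near: h.
  by rewrite [X in `|X|]/(f (h + x) - (f x + 'd f x h)) fgh.
have dd := diff_unique dfc dgx.
by apply/diff_locallyP; rewrite dd.
Unshelve. all: by end_near. Qed.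

Lemma derive_linear (R : numFieldType) (V W : normedModType R) (f : V -> W) (x : V)
    (I : Type) (s : seq I) (c : I -> R) (v : I -> V) :
  differentiable f x ->
  'D_(\sum_(i <- s) c i *: v i) f x = \sum_(i <- s) c i *: 'D_(v i) f x.
Proof.
move=> df; rewrite deriveE // linear_sum; apply: eq_bigr => i _.
by rewrite linearZ deriveE.
Qed.

Section Smooth.
Context {R : realType}.
Implicit Types (p : coords R) (i : 'I_4).

Lemma ucover_near p : ucover p -> \forall q \near p, ucover q.
Proof.
move=> pc; have : open (@ucover R).
  rewrite (_ : @ucover R = (fun q : coords R => q 0 ir) @^-1` [set x | 0 < x]) //.
  apply: open_comp => [q _|]; [exact: coord_continuous|exact: open_gt].
by rewrite openE => /(_ _ pc).
Qed.

(** [ucover] is open, so equality over it is equality of germs at its points; hence derivatives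
    never see the arbitrary values off the cover. *)
Lemma eq_on_ucover_near (W : Type) (F G : coords R -> W) p :
  eq_on_ucover F G -> ucover p -> \forall q \near p, F q = G q.
Proof. by move=> FG pc; near=> q; apply: FG; near: q; exact: ucover_near.
Unshelve. all: by end_near. Qed.

Lemma ucover_shift p (c : R) : ucover (p + c *: delta_mx 0 iphi) <-> ucover p.
Proof. by rewrite /ucover /= !mxE eqxx /= mulr0 addr0. Qed.

Section Normed.
Context (W : normedModType R).
Implicit Types F G : coords R -> W.

Lemma eq_differentiable F G p : eq_on_ucover F G -> ucover p ->
  differentiable F p -> differentiable G p.
Proof. by move=> FG pc; apply: near_eq_differentiable; exact: eq_on_ucover_near. Qed.

Lemma eq_derive F G p v : eq_on_ucover F G -> ucover p -> 'D_v F p = 'D_v G p.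
Proof. by move=> FG pc; apply: near_eq_derive; exact: eq_on_ucover_near. Qed.

Lemma eq_partial i F G : eq_on_ucover F G -> eq_on_ucover (partial i F) (partial i G).
Proof. by move=> FG p pc; exact: eq_derive. Qed.

Lemma eq_iter_partial s F G :
  eq_on_ucover F G -> eq_on_ucover (iter_partial s F) (iter_partial s G).
Proof. by move=> FG; elim: s => //= i s IH; exact: eq_partial. Qed.

Lemma eq_periodic F G : eq_on_ucover F G -> Defs.periodic F -> Defs.periodic G.
Proof.
move=> FG perF p pc; rewrite -(FG p pc) -(perF p pc) -FG //.
exact/ucover_shift.
Qed.

Lemma eq_smooth F G : eq_on_ucover F G -> smooth F -> smooth G.
Proof.
move=> FG [dF perF]; split; last exact: eq_periodic perF.
by move=> s p pc; apply: (eq_differentiable _ pc (dF s p pc)); exact: eq_iter_partial.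
Qed.

Lemma smooth_differentiable F p : smooth F -> ucover p -> differentiable F p.
Proof. by move=> [dF _]; exact: (dF [::]). Qed.

Lemma periodic_partial i F : Defs.periodic F -> Defs.periodic (partial i F).
Proof.
move=> perF p pc; rewrite -[RHS](eq_derive _ perF pc) /partial /derive.
by under [in RHS]eq_fun do rewrite /= -addrA.
Qed.

Lemma smooth_partial i F : smooth F -> smooth (partial i F).
Proof.
move=> [dF perF]; split; last exact: periodic_partial.
by move=> s; have := dF (rcons s i); rewrite /iter_partial foldr_rcons.
Qed.

Lemma smooth_iter_partial s F : smooth F -> smooth (iter_partial s F).
Proof. by move=> dF; elim: s => //= i s IH; exact: smooth_partial. Qed.

End Normed.

Lemma partial_comm i k (F : scalar_field R) p : smooth F -> ucover p ->
  partial i (partial k F) p = partial k (partial i F) p.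
Proof.
move=> sF pc; have dF : forall j, \forall q \near p, derivable F q (delta_mx 0 j).
  move=> j; near=> q; apply: diff_derivable; apply: smooth_differentiable => //.
  by near: q; exact: ucover_near.
by apply: derive_comm => //; apply: smooth_differentiable => //; exact: smooth_partial.
Unshelve. all: by end_near. Qed.

Lemma differentiable_row n (F : coords R -> 'rV[R]_n) p :
  (forall k, differentiable (fun q => F q 0 k) p) -> differentiable F p.
Proof.
move=> dF; have -> : F = \sum_(k < n) (fun q => F q 0 k *: delta_mx 0 k).
  by apply/funext => q; rewrite fct_sumE [LHS]row_sum_delta.
by apply: differentiable_sum => k; exact: differentiableZl.
Qed.

Lemma differentiable_entry n (F : coords R -> 'rV[R]_n) p (k : 'I_n) :
  differentiable F p -> differentiable (fun q => F q 0 k) p.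
Proof.
move=> dF; apply: (differentiable_comp (g := fun N : 'rV[R]_n => N 0 k)) => //.
exact: differentiable_coord.
Qed.

Lemma derive_entry n (F : coords R -> 'rV[R]_n) p v (k : 'I_n) :
  differentiable F p -> ('D_v F p) 0 k = 'D_v (fun q => F q 0 k) p.
Proof. by move=> dF; rewrite derive_mx ?mxE //; exact: diff_derivable. Qed.

Lemma smooth_row n (F : coords R -> 'rV[R]_n) :
  (forall k, smooth (fun q => F q 0 k)) -> smooth F.
Proof.
move=> sF; split; last first.
  by move=> p pc; apply/rowP => k; have [_ /(_ p pc)] := sF k.
(* Both claims go through one induction: entries commute with a further derivative only where the
   vector-valued iterate is differentiable, and its differentiability is read off from its
   entries. *)
suff H s : (forall p, ucover p -> differentiable (iter_partial s F) p) /\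
    forall k, eq_on_ucover (iter_partial s (fun q => F q 0 k))
      (fun q => iter_partial s F q 0 k).
  by move=> s; have [] := H s.
elim: s => [|i s [dF FE]] /=.
  split => // p pc; apply: differentiable_row => k.
  exact: smooth_differentiable.
have E k : eq_on_ucover (partial i (iter_partial s (fun q => F q 0 k)))
    (fun q => partial i (iter_partial s F) q 0 k).
  move=> p pc; rewrite /partial derive_entry; last exact: dF.
  by apply: eq_derive pc; exact: FE.
split=> // p pc; apply: differentiable_row => k.
apply: (eq_differentiable (E k)) => //.
by have [+ _] := sF k => /(_ (i :: s) p pc).
Qed.

Lemma smooth_entry n (F : coords R -> 'rV[R]_n) (k : 'I_n) :
  smooth F -> smooth (fun q => F q 0 k).
Proof.
move=> sF; split; last first.
  by move=> p pc; have [_ /(_ p pc) ->] := sF.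
have FE s : eq_on_ucover (fun q => iter_partial s F q 0 k) (iter_partial s (fun q => F q 0 k)).
  elim: s => [|i s IH] //= p pc; rewrite /partial derive_entry.
    by apply: eq_derive pc; exact: IH.
  by apply: smooth_differentiable pc; exact: smooth_iter_partial.
move=> s p pc; apply: (eq_differentiable (FE s)) => //; apply: differentiable_entry.
by apply: smooth_differentiable pc; exact: smooth_iter_partial.
Qed.

(** The algebra generated by [S] and the constants. It replaces a product formula for iterated
    partial derivatives: it suffices that the derivatives of generators fall back into the
    algebra. *)
Inductive generated (S : scalar_field R -> Prop) : scalar_field R -> Prop :=
| gen_base F : S F -> generated S F
| gen_cst c : generated S (cst c)
| gen_add F G : generated S F -> generated S G -> generated S (F \+ G)
| gen_mul F G : generated S F -> generated S G -> generated S (F \* G).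

(** By the sum and product rules, closure under [partial] passes from the generators to the whole
    algebra, so every iterated derivative is again a generated, hence differentiable, function over
    the cover. *)
Lemma generated_smooth (S : scalar_field R -> Prop) :
  (forall F, S F -> [/\ Defs.periodic F, forall p, ucover p -> differentiable F p &
     forall i, exists2 G, generated S G & eq_on_ucover (partial i F) G]) ->
  forall F, generated S F -> smooth F.
Proof.
move=> HS.
have step F : generated S F -> (forall p, ucover p -> differentiable F p) /\
    forall i, exists2 G, generated S G & eq_on_ucover (partial i F) G.
  elim=> {F} [F SF|c|F G _ [dF pF] _ [dG pG]|F G SF [dF pF] SG [dG pG]].
  - by have [] := HS F SF.
  - split=> [p _|i]; first exact: differentiable_cst.
    by exists (cst 0); [exact: gen_cst|move=> p _; exact: derive_cst].
  - split=> [p pc|i]; first by apply: differentiableD; [exact: dF|exact: dG].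
    have [F' SF' FE] := pF i; have [G' SG' GE] := pG i.
    exists (F' \+ G'); first exact: gen_add.
    move=> p pc; rewrite /= -FE // -GE //; apply: deriveD.
      by apply: diff_derivable; exact: dF.
    by apply: diff_derivable; exact: dG.
  - split=> [p pc|i]; first by apply: differentiableM; [exact: dF|exact: dG].
    have [F' SF' FE] := pF i; have [G' SG' GE] := pG i.
    exists ((F \* G') \+ (G \* F')); first by apply: gen_add; exact: gen_mul.
    move=> p pc; rewrite /= -FE // -GE //; apply: deriveM.
      by apply: diff_derivable; exact: dF.
    by apply: diff_derivable; exact: dG.
have iter F s : generated S F ->
    exists2 G, generated S G & eq_on_ucover (iter_partial s F) G.
  move=> SF; elim: s => [|i s [G SG GE]]; first by exists F.
  have [_ /(_ i)[G' SG' GE']] := step G SG.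
  by exists G' => // p pc; rewrite -GE' //; exact: eq_partial.
move=> F SF; split=> [s p pc|].
  have [G SG GE] := iter F s SF; apply: (eq_differentiable (F := G)) => //.
    by move=> q qc; rewrite GE.
  by have [+ _] := step G SG; exact.
elim: SF => {F} [F /HS []|c p pc|F G _ perF _ perG p pc|F G _ perF _ perG p pc] //=.
  by rewrite perF ?perG.
by rewrite perF ?perG.
Qed.

(** Taking all smooth functions as generators turns [generated_smooth] into closure of smoothness
    under sums and products. *)
Lemma smooth_generated F : generated (@smooth R R) F -> smooth F.
Proof.
apply: generated_smooth => {}F sF; split; first by have [] := sF.
  by move=> p pc; exact: smooth_differentiable.
by move=> i; exists (partial i F) => //; apply: gen_base; exact: smooth_partial.
Qed.

Lemma smooth_cst (c : R) : smooth (cst c : scalar_field R).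
Proof. by apply: smooth_generated; exact: gen_cst. Qed.

Lemma smoothD (F G : scalar_field R) : smooth F -> smooth G -> smooth (F \+ G).
Proof. by move=> sF sG; apply: smooth_generated; apply: gen_add; exact: gen_base. Qed.

Lemma smoothM (F G : scalar_field R) : smooth F -> smooth G -> smooth (F \* G).
Proof. by move=> sF sG; apply: smooth_generated; apply: gen_mul; exact: gen_base. Qed.

Lemma smooth_sum (I : Type) (s : seq I) (F : I -> scalar_field R) :
  (forall j, smooth (F j)) -> smooth (fun p => \sum_(j <- s) F j p).
Proof.
move=> sF; elim: s => [|i s IH].
  by apply: eq_smooth (smooth_cst 0) => p _; rewrite big_nil.
by apply: eq_smooth (smoothD (sF i) IH) => p _; rewrite big_cons.
Qed.

End Smooth.

(** * Affine connections in the coordinate frame *)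

Section Connection.
Context {R : realType}.
Implicit Types (p : coords R) (X Y Z U V : vfield R).

Definition frame (i : 'I_4) : vfield R := cst (delta_mx 0 i).

Definition entry (k : 'I_4) X : scalar_field R := fun p => X p 0 k.

Lemma smooth_frame i : smooth (frame i).
Proof. by apply: smooth_row => k; exact: smooth_cst. Qed.

Lemma smooth_fscale (c : scalar_field R) X : smooth c -> smooth X -> smooth (fscale c X).
Proof.
move=> sc sX; apply: smooth_row => k.
apply: eq_smooth (smoothM sc (smooth_entry k sX)) => p _.
by rewrite /fscale mxE.
Qed.

Lemma smooth_vsum (I : Type) (s : seq I) (F : I -> vfield R) :
  (forall i, smooth (F i)) -> smooth (fun p => \sum_(i <- s) F i p).
Proof.
move=> sF; apply: smooth_row => k.
apply: eq_smooth (smooth_sum s (fun i => smooth_entry k (sF i))) => p _.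
by rewrite summxE.
Qed.

Lemma smooth_vadd X Y : smooth X -> smooth Y -> smooth (X \+ Y).
Proof.
move=> sX sY; apply: smooth_row => k.
by apply: eq_smooth (smoothD (smooth_entry k sX) (smooth_entry k sY)) => p _; rewrite mxE.
Qed.

Lemma smooth_vsub X Y : smooth X -> smooth Y -> smooth (fun p => X p - Y p).
Proof.
move=> sX sY; apply: eq_smooth (smooth_vadd sX (smooth_fscale (smooth_cst (-1)) sY)) => p _.
by rewrite /fscale /= scaleN1r.
Qed.

Lemma frame_sum X : X = fun p => \sum_i fscale (entry i X) (frame i) p.
Proof. by apply/funext => p; rewrite [LHS]row_sum_delta. Qed.

Lemma lie_deriv_partial (W : normedModType R) X (F : coords R -> W) p :
  differentiable F p -> lie_deriv X F p = \sum_i X p 0 i *: partial i F p.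
Proof. by move=> dF; rewrite /lie_deriv {1}[X p]row_sum_delta derive_linear. Qed.

Context (nabla : vfield R -> vfield R -> vfield R).
Context (conn : affine_connection nabla).

Lemma conn0r X : smooth X -> eq_on_ucover (nabla X (cst 0)) (cst 0).
Proof.
move=> sX p pc; have -> : cst 0 = fscale (cst 0) X by apply/funext => q; rewrite /fscale scale0r.
rewrite (conn_leibniz conn) //; last exact: smooth_cst.
by rewrite /fscale /lie_deriv /= derive_cst !scale0r addr0.
Qed.

Lemma conn0l Y : smooth Y -> eq_on_ucover (nabla (cst 0) Y) (cst 0).
Proof.
move=> sY p pc; have -> : cst 0 = fscale (cst 0) Y by apply/funext => q; rewrite /fscale scale0r.
rewrite (conn_scalel conn) //; last exact: smooth_cst.
by rewrite /fscale /= !scale0r.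
Qed.

Lemma conn_suml (I : Type) (s : seq I) (X : I -> vfield R) Y :
  (forall i, smooth (X i)) -> smooth Y ->
  eq_on_ucover (nabla (fun p => \sum_(i <- s) X i p) Y)
    (fun p => \sum_(i <- s) nabla (X i) Y p).
Proof.
move=> sX sY; elim: s => [|i s IH] p pc.
  by rewrite big_nil; under eq_fun do rewrite big_nil; rewrite conn0l.
rewrite big_cons -IH //; under eq_fun do rewrite big_cons.
by rewrite (conn_addl conn) //; exact: smooth_vsum.
Qed.

Lemma conn_sumr (I : Type) (s : seq I) X (Y : I -> vfield R) :
  smooth X -> (forall i, smooth (Y i)) ->
  eq_on_ucover (nabla X (fun p => \sum_(i <- s) Y i p))
    (fun p => \sum_(i <- s) nabla X (Y i) p).
Proof.
move=> sX sY; elim: s => [|i s IH] p pc.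
  by rewrite big_nil; under eq_fun do rewrite big_nil; rewrite conn0r.
rewrite big_cons -IH //; under eq_fun do rewrite big_cons.
by rewrite (conn_addr conn) //; exact: smooth_vsum.
Qed.

(* A field vanishing over [ucover] is its own product with a function vanishing
   there, so the Leibniz rule makes the connection local. *)
Lemma conn_eqr X Y Y' : smooth X -> smooth Y -> eq_on_ucover Y Y' ->
  eq_on_ucover (nabla X Y) (nabla X Y').
Proof.
move=> sX sY YY' p pc; pose a : scalar_field R := \1_(~` @ucover R).
have a0 : eq_on_ucover a (cst 0).
  by move=> q qc; rewrite /a indicE memNset //; apply/negP; rewrite negbK inE.
have sa : smooth a by apply: eq_smooth (smooth_cst 0) => q qc; rewrite a0.
have sY' : smooth Y' := eq_smooth YY' sY.
pose D : vfield R := fun q => Y q - Y' q.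
have sD : smooth D := smooth_vsub sY sY'.
have -> : Y = Y' \+ fscale a D.
  apply/funext => q; rewrite /fscale /D /=; have [qc|qc] := pselect (ucover q).
    by rewrite YY' // subrr scaler0 addr0.
  by rewrite /a indicE mem_set // scale1r addrC subrK.
rewrite (conn_addr conn) //=; last exact: smooth_fscale.
rewrite (conn_leibniz conn) //= /fscale a0 //= /D YY' // subrr.
by rewrite scaler0 scale0r !addr0.
Qed.

Lemma conn_frame X Y : smooth X -> smooth Y ->
  eq_on_ucover (nabla X Y) (fun p => \sum_i X p 0 i *: nabla (frame i) Y p).
Proof.
move=> sX sY p pc; rewrite {1}(frame_sum X) conn_suml //; last first.
  by move=> i; apply: smooth_fscale; [exact: smooth_entry|exact: smooth_frame].
apply: eq_bigr => i _; rewrite (conn_scalel conn) //; first exact: smooth_entry.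
exact: smooth_frame.
Qed.

Lemma conn_sum_leibniz X (c : 'I_4 -> scalar_field R) (Y : 'I_4 -> vfield R) p :
  smooth X -> (forall i, smooth (c i)) -> (forall i, smooth (Y i)) -> ucover p ->
  nabla X (fun q => \sum_i fscale (c i) (Y i) q) p =
  \sum_i (lie_deriv X (c i) p *: Y i p + c i p *: nabla X (Y i) p).
Proof.
move=> sX sc sY pc; rewrite conn_sumr //; last by move=> i; exact: smooth_fscale.
by apply: eq_bigr => i _; rewrite (conn_leibniz conn).
Qed.

(** The curvature endomorphism of two coordinate fields: their bracket vanishes, and the sign
    convention puts [j] outermost in the positive term. *)
Definition curv_frame i j Z p :=
  nabla (frame j) (nabla (frame i) Z) p - nabla (frame i) (nabla (frame j) Z) p.

Hint Resolve smooth_frame smooth_entry smooth_partial : core.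

(** The first double sum is the part that is not tensorial in [U] and [V]. Antisymmetrized, it is
    the derivative along the bracket, and so drops out of the curvature. *)
Lemma conn_conn_frame U V Z p : smooth U -> smooth V -> smooth Z -> ucover p ->
  nabla U (nabla V Z) p =
  \sum_i \sum_j (U p 0 i * partial i (entry j V) p) *: nabla (frame j) Z p
  + \sum_i \sum_j (U p 0 i * V p 0 j) *: nabla (frame i) (nabla (frame j) Z) p.
Proof.
move=> sU sV sZ pc.
have sN X Y : smooth X -> smooth Y -> smooth (nabla X Y) by exact: conn_smooth.
rewrite conn_frame //; last exact: sN.
rewrite -big_split; apply: eq_bigr => i _.
(* The frame expansion of the inner field holds only over the cover, so substituting it under
   [nabla] takes the locality of the connection. *)
rewrite (conn_eqr (smooth_frame i) (sN _ _ sV sZ) (conn_frame sV sZ)) //.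
rewrite (conn_sum_leibniz (c := fun j => entry j V) (Y := fun j => nabla (frame j) Z)) //.
- rewrite -big_split scaler_sumr; apply: eq_bigr => j _.
  by rewrite scalerDr !scalerA.
- by move=> j; exact: smooth_entry.
- by move=> j; apply: sN.
Qed.

Lemma bracket_entry U V j p : smooth U -> smooth V -> ucover p ->
  bracket U V p 0 j =
  \sum_i (U p 0 i * partial i (entry j V) p - V p 0 i * partial i (entry j U) p).
Proof.
move=> sU sV pc; rewrite /bracket mxE [X in _ + X]mxE !lie_deriv_partial; last 2 first.
- exact: smooth_differentiable.
- exact: smooth_differentiable.
rewrite !summxE -sumrB; apply: eq_bigr => i _.
by rewrite !mxE /partial !derive_entry //; exact: smooth_differentiable.
Qed.

Lemma curv_endo_frame U V Z p : smooth U -> smooth V -> smooth (bracket U V) ->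
  smooth Z -> ucover p ->
  curv_endo nabla U V Z p = \sum_i \sum_j (U p 0 i * V p 0 j) *: curv_frame i j Z p.
Proof.
move=> sU sV sB sZ pc; rewrite /curv_endo conn_frame // !conn_conn_frame //.
under eq_bigr do rewrite bracket_entry // scaler_suml.
rewrite exchange_big /=.
under eq_bigr do under eq_bigr do rewrite scalerBl.
under eq_bigr do rewrite sumrB; rewrite sumrB.
under [RHS]eq_bigr do under eq_bigr do rewrite /curv_frame scalerBr.
under [RHS]eq_bigr do rewrite sumrB; rewrite sumrB.
rewrite [X in _ = X - _]exchange_big /=.
under [X in _ = X - _]eq_bigr do under eq_bigr do rewrite mulrC.
move: (\sum_i _) (\sum_i _) (\sum_i _) (\sum_i _) => a b c d.
by apply/rowP => m; rewrite !mxE; ring.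
Qed.

(** In the second covariant derivative of [Z], the terms with first derivatives of its components
    are symmetric in the two frame directions, and those with second derivatives are so by
    [partial_comm]; the commutator keeps only undifferentiated components. *)
Lemma curv_frame_tensorial i j Z p : smooth Z -> ucover p ->
  curv_frame i j Z p = \sum_k Z p 0 k *: curv_frame i j (frame k) p.
Proof.
move=> sZ pc.
have sN X Y : smooth X -> smooth Y -> smooth (nabla X Y) by exact: conn_smooth.
have lie_frame m (c : scalar_field R) q : lie_deriv (frame m) c q = partial m c q by [].
have N1 m : eq_on_ucover (nabla (frame m) Z) ((fun q =>
    \sum_k fscale (partial m (entry k Z)) (frame k) q) \+
    (fun q => \sum_k fscale (entry k Z) (nabla (frame m) (frame k)) q)).
  move=> q qc; rewrite {1}(frame_sum Z) conn_sum_leibniz //; last first.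
    by move=> k; exact: smooth_entry.
  by rewrite /= -big_split.
have N2 m l : nabla (frame l) (nabla (frame m) Z) p = \sum_k
    ((partial l (partial m (entry k Z)) p *: frame k p
      + partial m (entry k Z) p *: nabla (frame l) (frame k) p)
     + (partial l (entry k Z) p *: nabla (frame m) (frame k) p
       + Z p 0 k *: nabla (frame l) (nabla (frame m) (frame k)) p)).
  rewrite (conn_eqr (smooth_frame l) (sN _ _ (smooth_frame m) sZ) (N1 m)) //.
  have s1 : forall k, smooth (partial m (entry k Z)).
    by move=> k; apply: smooth_partial; exact: smooth_entry.
  have s2 : forall k, smooth (entry k Z) by move=> k; exact: smooth_entry.
  have s3 : forall k, smooth (nabla (frame m) (frame k)) by move=> k; exact: sN.
  rewrite (conn_addr conn) //=; last 2 first.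
  - by apply: smooth_vsum => k; exact: smooth_fscale.
  - by apply: smooth_vsum => k; exact: smooth_fscale.
  by rewrite !conn_sum_leibniz // -big_split.
rewrite /curv_frame !N2 -sumrB; apply: eq_bigr => k _.
rewrite (partial_comm i j (smooth_entry k sZ) pc) scalerBr.
by apply/rowP => m; rewrite !mxE; ring.
Qed.

Lemma curv_endo_tensorial U V Z p : smooth U -> smooth V -> smooth (bracket U V) ->
  smooth Z -> ucover p ->
  curv_endo nabla U V Z p = \sum_i \sum_j \sum_k
    (U p 0 i * V p 0 j * Z p 0 k) *: curv_frame i j (frame k) p.
Proof.
move=> sU sV sB sZ pc; rewrite curv_endo_frame //.
apply: eq_bigr => i _; apply: eq_bigr => j _.
rewrite curv_frame_tensorial // scaler_sumr.
by apply: eq_bigr => k _; rewrite scalerA.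
Qed.

Lemma conn_conn_christoffel (i j k m : 'I_4) p : ucover p ->
  nabla (frame j) (nabla (frame i) (frame k)) p 0 m =
  partial j (entry m (nabla (frame i) (frame k))) p +
  \sum_l nabla (frame i) (frame k) p 0 l * nabla (frame j) (frame l) p 0 m.
Proof.
move=> pc; rewrite {1}(frame_sum (nabla (frame i) (frame k))) conn_sum_leibniz //; last first.
  by move=> l; apply: smooth_entry; exact: conn_smooth.
rewrite big_split mxE !summxE /=; congr (_ + _).
  rewrite (bigD1 m) //= big1 ?addr0 ?mxE ?eqxx /= ?mulr1 // => l lm.
  by rewrite !mxE eq_sym (negbTE lm) andbF mulr0.
by apply: eq_bigr => l _; rewrite mxE.
Qed.

End Connection.

(** * Algebra of the curvature tensor *)

Section Christoffel.
Context (R : fieldType).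

(* Component k of nabla_{E_i} E_j for a diagonal metric whose entries h_n depend
   on the coordinate of index 1 only, with b n = h_n' / (2 h_n) and
   q n = h_n / h_1. *)
Definition christoffel (b q : nat -> R) (i j k : nat) : R :=
  ((i == 1) && (j == k))%:R * b j + ((j == 1) && (i == k))%:R * b i
  - ((i == j) && (k == 1))%:R * (q i * b i).

(* The derivative of [christoffel], given b' for that of b and
   using q_n' = 2 (b_n - b_1) q_n. *)
Definition dchristoffel (b b' q : nat -> R) (i j k : nat) : R :=
  ((i == 1) && (j == k))%:R * b' j + ((j == 1) && (i == k))%:R * b' i
  - ((i == j) && (k == 1))%:R * (2 * (b i - b 1%N) * q i * b i + q i * b' i).

(* h_1 kappa_ij, meaningful for i != j. *)
Definition sect (b b' : nat -> R) (i j : nat) : R :=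
  if i == 1 then b' j + b j ^+ 2 - b 1%N * b j
  else if j == 1 then b' i + b i ^+ 2 - b 1%N * b i else b i * b j.

Lemma sectC b b' i j : sect b b' i j = sect b b' j i.
Proof.
rewrite /sect; case: (i =P 1%N) => [ei|_]; case: (j =P 1%N) => [ej|_] //.
  by rewrite ei ej.
exact: mulrC.
Qed.

(** The left side is component [m] of the curvature of E_i, E_j on E_k written in Christoffel
    symbols, the Kronecker factors standing for derivatives along the coordinate of index 1. It is
    checked on all 256 index quadruples; for i = j both sides vanish, whatever [sect] is there. *)
Lemma curv_christoffel (b b' q : nat -> R) (i j k m : 'I_4) : q 1%N = 1 ->
  ((j == 1 :> nat)%:R * dchristoffel b b' q i k m +
    \sum_(l < 4) christoffel b q i k l * christoffel b q j l m) -
  ((i == 1 :> nat)%:R * dchristoffel b b' q j k m +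
    \sum_(l < 4) christoffel b q j k l * christoffel b q i l m)
  = sect b b' i j * ((j == k)%:R * q j * (i == m)%:R - (i == k)%:R * q i * (j == m)%:R).
Proof.
move=> q1; rewrite !big_ord_recl !big_ord0 /christoffel /dchristoffel /sect.
case: i => [[|[|[|[|?]]]] ?] //; case: j => [[|[|[|[|?]]]] ?] //;
case: k => [[|[|[|[|?]]]] ?] //; case: m => [[|[|[|[|?]]]] ?] //;
rewrite /= /bump /= -?[Ordinal _ == _]/(_ == _ :> nat) /= ?q1.
all: try ring.
Qed.
End Christoffel.

Lemma sum4 (V : nmodType) (F : 'I_4 -> V) :
  \sum_(i < 4) F i = F it + F ir + F iz + F iphi.
Proof.
rewrite !big_ord_recl big_ord0 addr0 !addrA.
by congr (_ + _ + _ + _); congr F; exact: val_inj.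
Qed.

Section BivectorAction.
Context (R : fieldType).
Implicit Types (K : nat -> nat -> R) (h : nat -> R) (u v z : 'rV[R]_4).

(* With K = 1 this is (u /\_h v) z; in general the bivector u /\ v is first
   rescaled componentwise by K. *)
Definition biv_act K h u v z : 'rV[R]_4 := \row_i \sum_(j < 4)
  K i j * (u 0 i * v 0 j - u 0 j * v 0 i) * h j * z 0 j.

Definition diag_form h u v := \sum_(i < 4) u 0 i * h i * v 0 i.

Definition biv_form K h z0 z1 z2 z3 := diag_form h (biv_act K h z0 z1 z2) z3.

(* The three values on the blocks of pairs: P on {t, z}, Q on {r, phi}, L on the
   pairs across. *)
Definition block_weights (L P Q : R) (i j : nat) : R :=
  match i, j with
  | 0, 2 | 2, 0 => P
  | 1, 3 | 3, 1 => Q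
  | _, _ => L
  end.

(** A diagonal weight multiplies u_i v_i - u_i v_i = 0, so the conventional values of weights at i =
    j are harmless. *)
Lemma eq_biv_act K K' h u v z : (forall i j : 'I_4, i != j -> K i j = K' i j) ->
  biv_act K h u v z = biv_act K' h u v z.
Proof.
move=> KK'; apply/rowP => i; rewrite !mxE; apply: eq_bigr => j _.
by have [->|ij] := eqVneq i j; [rewrite subrr !(mulr0, mul0r)|rewrite KK'].
Qed.

(** [T] is L times the constant-curvature tensor of [h], plus (P - L) and (Q - L) times squares of
    the area forms of the two planes. The first is killed by every [h]-skew endomorphism, and each
    area form by rotations of either plane. *)
Lemma biv_form_block L P Q h u v z0 z1 z2 z3 :
  let K := block_weights L P Q in
  let A := biv_act K h u v in let W := biv_act (fun _ _ => 1) h u v in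
  let T := biv_form K h in
  T (A z0) z1 z2 z3 + T z0 (A z1) z2 z3 + T z0 z1 (A z2) z3 + T z0 z1 z2 (A z3)
  = L * (T (W z0) z1 z2 z3 + T z0 (W z1) z2 z3 + T z0 z1 (W z2) z3 + T z0 z1 z2 (W z3)).
Proof.
move=> K A W T.
(* A - L W rotates the (t, z)-plane and the (r, phi)-plane. *)
pose al := (P - L) * (u 0 it * v 0 iz - u 0 iz * v 0 it).
pose be := (Q - L) * (u 0 ir * v 0 iphi - u 0 iphi * v 0 ir).
have A0 z : A z 0 it = L * W z 0 it + al * h 2%N * z 0 iz.
  by rewrite !mxE !sum4 /K /al /=; ring.
have A1 z : A z 0 ir = L * W z 0 ir + be * h 3%N * z 0 iphi.
  by rewrite !mxE !sum4 /K /be /=; ring.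
have A2 z : A z 0 iz = L * W z 0 iz - al * h 0%N * z 0 it.
  by rewrite !mxE !sum4 /K /al /=; ring.
have A3 z : A z 0 iphi = L * W z 0 iphi - be * h 1%N * z 0 ir.
  by rewrite !mxE !sum4 /K /be /=; ring.
(* [T] in the Plücker coordinates of the bivectors x /\ y and z /\ w, one term for each pair of
   axes. *)
have TE x y z w : T x y z w =
  L * (h 0%N * h 1%N * (x 0 it * y 0 ir - x 0 ir * y 0 it) * (z 0 ir * w 0 it - z 0 it * w 0 ir)
   + h 0%N * h 3%N * (x 0 it * y 0 iphi - x 0 iphi * y 0 it) * (z 0 iphi * w 0 it - z 0 it * w 0 iphi)
   + h 1%N * h 2%N * (x 0 ir * y 0 iz - x 0 iz * y 0 ir) * (z 0 iz * w 0 ir - z 0 ir * w 0 iz)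
   + h 2%N * h 3%N * (x 0 iz * y 0 iphi - x 0 iphi * y 0 iz) * (z 0 iphi * w 0 iz - z 0 iz * w 0 iphi))
  + P * (h 0%N * h 2%N * (x 0 it * y 0 iz - x 0 iz * y 0 it) * (z 0 iz * w 0 it - z 0 it * w 0 iz))
  + Q * (h 1%N * h 3%N * (x 0 ir * y 0 iphi - x 0 iphi * y 0 ir) * (z 0 iphi * w 0 ir - z 0 ir * w 0 iphi)).
  by rewrite /T /biv_form /diag_form sum4 !mxE !sum4 /K /=; ring.
rewrite !TE !(A0, A1, A2, A3).
(* By multilinearity the [W] terms match on both sides, so arbitrary vectors may replace them; the
   identity left is that the two rotations annihilate [T]. *)
move: (W z0) (W z1) (W z2) (W z3) => w0 w1 w2 w3.
by ring.
Qed.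
End BivectorAction.

(** * The Levi-Civita connection of the metric *)

Section Radial.
Context {R : realType}.
Implicit Types (p : coords R) (phi : R -> R).

Definition radial phi : scalar_field R := fun p => phi (p 0 ir).

Lemma differentiable_radial phi p :
  derivable phi (p 0 ir) 1 -> differentiable (radial phi) p.
Proof.
move=> /derivable1_diffP dphi; apply: (differentiable_comp (g := phi)) => //.
exact: differentiable_coord.
Qed.

Lemma partial_radial (i : 'I_4) phi dphi p : is_derive (p 0 ir) 1 phi dphi ->
  partial i (radial phi) p = (i == 1 :> nat)%:R * dphi.
Proof.
move=> [_ <-]; rewrite /partial /derive /radial /=.
under [in LHS]eq_fun do rewrite !mxE /=.
rewrite [ir == i]eq_sym; have [->|ni] := eqVneq i ir; first by rewrite mul1r.
rewrite -val_eqE /= in ni; rewrite (negbTE ni) mul0r.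
under eq_fun do rewrite mulr0 add0r subrr scaler0.
exact: lim_cst.
Qed.

Lemma radial_periodic phi : Defs.periodic (radial phi).
Proof. by move=> p pc; rewrite /radial !mxE /= mulr0 addr0. Qed.

End Radial.

Section Metric.
Context {R : realType}.
Context (f : R -> R).
Implicit Types (r : R) (p : coords R) (X Y Z U V : vfield R).
Context (f_smooth : forall (n : nat) (r : R), 0 < r -> derivable (f^`(n)%classic) r 1).

Definition warp (n : nat) (r : R) : R :=
  [:: - expR (2 * f r); expR (2 * f r); expR (2 * f r);
      r ^+ 2 * expR (- (2 * f r))]`_n.

(* Half the logarithmic derivative of [warp n]. *)
Definition dlogwarp (n : nat) (r : R) : R :=
  if n == 3 then r^-1 - f^`()%classic r else f^`()%classic r.

Definition d2logwarp (n : nat) (r : R) : R :=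
  if n == 3 then - r^-2 - f^`(2)%classic r else f^`(2)%classic r.

Let is_derive_f r : 0 < r -> is_derive r 1 f (f^`()%classic r).
Proof. by move=> r0; rewrite derive1E; apply: derivableP; have := f_smooth (n := 0%N) r0; rewrite derive1n0. Qed.

Let is_derive_f1 r : 0 < r -> is_derive r 1 (f^`()%classic) (f^`(2)%classic r).
Proof. by move=> r0; rewrite derive1nS derive1n1 derive1E; apply: derivableP; have := f_smooth (n := 1%N) r0; rewrite derive1n1. Qed.

Lemma is_derive_expR_scale c r : 0 < r ->
  is_derive r 1 (fun x => expR (c * f x)) (c * f^`()%classic r * expR (c * f r)).
Proof.
move=> r0; have df := is_derive_f r0.
have d1 : is_derive r 1 (fun x => c * f x) (c * f^`()%classic r) by exact: is_deriveZ.
rewrite mulrC; exact: (@is_derive1_comp R expR (fun x => c * f x)).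
Qed.

Lemma is_derive_warp (i : 'I_4) r : 0 < r ->
  is_derive r 1 (warp i) (2 * dlogwarp i r * warp i r).
Proof.
move=> r0; have df := is_derive_f r0.
have dE c := is_derive_expR_scale c r0.
case: i => [[|[|[|[|n]]]] ni]; last (by []); rewrite /warp /dlogwarp /=.
- by apply: is_derive_eq; ring.
- exact: dE.
- exact: dE.
- have -> : (fun r0 => r0 ^+ 2 * expR (- (2 * f r0))) = (fun x => x ^+ 2) * (fun x => expR (- 2 * f x)).
    by apply/funext => x; rewrite -mulNr.
  apply: is_derive_eq.
  rewrite /GRing.scale /= -mulNr; field.
  by rewrite gt_eqF.
Qed.

Lemma warp_neq0 (i : 'I_4) r : 0 < r -> warp i r != 0.
Proof.
move=> r0; case: i => [[|[|[|[|n]]]] ni]; last (by []); rewrite /warp /=.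
- by rewrite oppr_eq0 gt_eqF ?expR_gt0.
- by rewrite gt_eqF ?expR_gt0.
- by rewrite gt_eqF ?expR_gt0.
- by rewrite gt_eqF // mulr_gt0 ?exprn_gt0 ?expR_gt0.
Qed.

Lemma is_derive_dlogwarp (n : nat) r : 0 < r ->
  is_derive r 1 (dlogwarp n) (d2logwarp n r).
Proof.
move=> r0; have df := is_derive_f1 r0.
rewrite /dlogwarp /d2logwarp; case: eqP => _ //.
have rn0 : r != 0 by rewrite gt_eqF.
have di : is_derive r 1 (fun x : R => x^-1) (- r^-2).
  apply: DeriveDef; first exact: derivableV.
  by rewrite deriveV // derive_id /GRing.scale /= mulr1.
exact: is_deriveB.
Qed.

Lemma is_derive_ratio (i : 'I_4) r : 0 < r ->
  is_derive r 1 (fun x => warp i x / warp 1 x)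
    (2 * (dlogwarp i r - dlogwarp 1 r) * (warp i r / warp 1 r)).
Proof.
move=> r0; have d1 := is_derive_warp i r0.
have d2 : is_derive r 1 (warp 1) (2 * dlogwarp 1 r * warp 1 r) := is_derive_warp ir r0.
have n0 : warp 1 r != 0 := warp_neq0 ir r0.
have d3 : is_derive r 1 (fun x : R => (warp 1 x)^-1) (- (2 * dlogwarp 1 r / warp 1 r)).
  apply: DeriveDef; first by apply: derivableV => //; exact: ex_derive.
  rewrite deriveV //.
  by rewrite derive_val /GRing.scale /=; field.
have -> : (fun x => warp i x / warp 1 x) = warp i * (fun x => (warp 1 x)^-1) by [].
apply: is_derive_eq; rewrite /GRing.scale /=; field.
exact: n0.
Qed.

Lemma innerE X Y p :
  inner (metric_of f) X Y p = diag_form (fun n => warp n (p 0 ir)) (X p) (Y p).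
Proof.
rewrite /inner /diag_form mxE; apply: eq_bigr => i _.
by rewrite mul_mx_diag !mxE.
Qed.

Lemma smooth_warp (i : 'I_4) : smooth (radial (warp i)).
Proof.
(* Generators closed under differentiation up to products: r' = 1, each derivative of [f] gives the
   next, and (e^(cf))' = c f' e^(cf). *)
pose S (F : scalar_field R) := [\/ F = radial id, exists n, F = radial (f^`(n)%classic) |
  exists c, F = radial (fun r => expR (c * f r))].
have gS F : generated S F -> smooth F.
  apply: generated_smooth => {}F [->|[n ->]|[c ->]]; split.
  - exact: radial_periodic.
  - by move=> p pc; apply: differentiable_radial; exact: derivable_id.
  - move=> j; exists (cst ((j == 1 :> nat)%:R)); first exact: gen_cst.
    by move=> p pc; rewrite (partial_radial _ (is_derive_id _ _)) mulr1.
  - exact: radial_periodic.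
  - by move=> p pc; apply: differentiable_radial; exact: f_smooth.
  - move=> j; exists (cst ((j == 1 :> nat)%:R) \* radial (f^`(n.+1)%classic)).
      by apply: gen_mul; [exact: gen_cst|apply: gen_base; constructor 2; exists n.+1].
    move=> p pc; rewrite (partial_radial _ (derivableP (f_smooth (n := n) pc))).
    by rewrite /radial -derive1E -derive1nS.
  - exact: radial_periodic.
  - by move=> p pc; apply: differentiable_radial; apply: ex_derive; exact: is_derive_expR_scale.
  - move=> j; exists (cst ((j == 1 :> nat)%:R * c) \* (radial (f^`(1)%classic) \* radial (fun r => expR (c * f r)))).
      apply: gen_mul; first exact: gen_cst.
      by apply: gen_mul; apply: gen_base; [constructor 2; exists 1|constructor 3; exists c].
    by move=> p pc; rewrite (partial_radial _ (is_derive_expR_scale c pc)) /radial /= !mulrA.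
have gE c : generated S (radial (fun r => expR (c * f r))).
  by apply: gen_base; constructor 3; exists c.
have gr : generated S (radial id) by apply: gen_base; constructor 1.
apply: gS; case: i => [[|[|[|[|n]]]] ni]; last (by []); rewrite /warp /=.
- have -> : radial (fun r => - expR (2 * f r)) = cst (-1) \* radial (fun r => expR (2 * f r)).
    by apply/funext => p; rewrite /radial /= mulN1r.
  by apply: gen_mul; first exact: gen_cst.
- exact: gE.
- exact: gE.
- have -> : radial (fun r => r ^+ 2 * expR (- (2 * f r))) =
      (radial id \* radial id) \* radial (fun r => expR (- 2 * f r)).
    by apply/funext => p; rewrite /radial /= expr2 mulNr.
  by apply: gen_mul => //; exact: gen_mul.
Qed.

Lemma smooth_inner X Y : smooth X -> smooth Y -> smooth (inner (metric_of f) X Y).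
Proof.
move=> sX sY.
have s (i : 'I_4) : smooth ((entry i X \* radial (warp i)) \* entry i Y).
  apply: smoothM; last exact: smooth_entry.
  by apply: smoothM; [exact: smooth_entry|exact: smooth_warp].
by apply: eq_smooth (smooth_sum (index_enum 'I_4) s) => p _; rewrite innerE.
Qed.

Lemma smooth_wedge U V Z : smooth U -> smooth V -> smooth Z ->
  smooth (wedge_endo (inner (metric_of f)) U V Z).
Proof.
move=> sU sV sZ; apply: (@smooth_vsub R (fscale _ U) (fscale _ V));
  by apply: smooth_fscale => //; exact: smooth_inner.
Qed.

Lemma wedge_biv_act U V Z p :
  wedge_endo (inner (metric_of f)) U V Z p =
  biv_act (fun _ _ => 1) (fun n => warp n (p 0 ir)) (U p) (V p) (Z p).
Proof.
apply/rowP => i; rewrite /wedge_endo !innerE !mxE /diag_form !mulr_suml -sumrB.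
by apply: eq_bigr => j _; ring.
Qed.

Context (nabla : vfield R -> vfield R -> vfield R).
Context (lc : levi_civita (metric_of f) nabla).

Let ratio (r : R) (n : nat) := warp n r / warp 1 r.

(** Koszul's formula for commuting fields: with [met] for metric compatibility and [tor] for
    symmetry in the lower indices, the combination m1 + m2 - m3 isolates 2 h_k times the wanted
    component. *)
Lemma conn_frame_christoffel (i j k : 'I_4) p : ucover p ->
  nabla (frame i) (frame j) p 0 k =
  christoffel (dlogwarp ^~ (p 0 ir)) (ratio (p 0 ir)) i j k.
Proof.
move=> pc; set h := fun n => warp n (p 0 ir).
have hn0 (l : 'I_4) : h l != 0 by exact: warp_neq0.
have inner_l (l : 'I_4) X : inner (metric_of f) (frame l) X p = h l * X p 0 l.
  rewrite innerE /diag_form (bigD1 l) //= big1 ?addr0 => [|m ml].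
    by rewrite mxE !eqxx mul1r.
  by rewrite mxE (negbTE ml) andbF !mul0r.
have inner_r (l : 'I_4) X : inner (metric_of f) X (frame l) p = h l * X p 0 l.
  rewrite innerE /diag_form (bigD1 l) //= big1 ?addr0 => [|m ml].
    by rewrite mxE !eqxx mulr1 mulrC.
  by rewrite [frame _ _ _ _]mxE (negbTE ml) andbF !mulr0.
have met (a b c : 'I_4) : ((a == 1 :> nat) && (b == c))%:R * (2 * dlogwarp b (p 0 ir) * h b) =
    h c * nabla (frame a) (frame b) p 0 c + h b * nabla (frame a) (frame c) p 0 b.
  rewrite -(inner_r c) -(inner_l b).
  have /= <- := lc_metric lc (smooth_frame a) (smooth_frame b) (smooth_frame c) pc.
  have -> : lie_deriv (frame a) (inner (metric_of f) (frame b) (frame c)) p =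
      partial a (cst (b == c)%:R \* radial (warp b)) p.
    rewrite /lie_deriv /partial /frame; congr ('D_ _ _ _); apply/funext => q.
    rewrite innerE /diag_form (bigD1 b) //= big1 ?addr0 => [|m ml].
      by rewrite !mxE !eqxx mul1r mulrC.
    by rewrite mxE (negbTE ml) andbF !mul0r.
  have dw := is_derive_warp b pc.
  rewrite [X in partial a X p](_ : _ = radial ((b == c)%:R *: warp b)) //.
  have dcw : is_derive (p 0 ir) 1 ((b == c)%:R *: warp b) ((b == c)%:R *: (2 * dlogwarp b (p 0 ir) * h b)).
    exact: is_deriveZ.
  by rewrite (partial_radial a dcw) -mulnb natrM -mulrA.
have tor (a b c : 'I_4) : nabla (frame a) (frame b) p 0 c = nabla (frame b) (frame a) p 0 c.
  have := lc_torsion_free lc (smooth_frame a) (smooth_frame b) pc.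
  rewrite /bracket /lie_deriv !derive_cst subrr => /eqP; rewrite subr_eq0 => /eqP.
  by move->.
have m1 := met i j k; have m2 := met j i k; have m3 := met k i j.
rewrite (tor j i k) in m2; rewrite (tor k i j) (tor k j i) in m3.
apply: (mulfI (hn0 k)); apply: (mulfI (_ : 2 != 0 :> R)); first by rewrite pnatr_eq0.
transitivity (((i == 1 :> nat) && (j == k))%:R * (2 * dlogwarp j (p 0 ir) * h j)
  + ((j == 1 :> nat) && (i == k))%:R * (2 * dlogwarp i (p 0 ir) * h i)
  - ((k == 1 :> nat) && (i == j))%:R * (2 * dlogwarp i (p 0 ir) * h i)).
  by rewrite m1 m2 m3; ring.
rewrite /christoffel /ratio -/(h i) -/(h 1%N) [(i == j :> nat) && _]andbC.
rewrite -!(inj_eq val_inj) /=.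
(* Under a Kronecker factor, indices may be identified in the other factor; this trades h_j or h_i
   for h_k. *)
have E (a b : nat) (c : bool) (x y : R) : (a = b -> x = y) -> (c && (a == b))%:R * x = (c && (a == b))%:R * y.
  by case: eqP => [ab ->//|_]; rewrite andbF !mul0r.
have -> : 2 * (h k * (((i == 1 :> nat) && (j == k :> nat))%:R * dlogwarp j (p 0 ir) +
   ((j == 1 :> nat) && (i == k :> nat))%:R * dlogwarp i (p 0 ir) -
   ((k == 1 :> nat) && (i == j :> nat))%:R * (h i / h 1%N * dlogwarp i (p 0 ir)))) =
   ((i == 1 :> nat) && (j == k :> nat))%:R * (2 * dlogwarp j (p 0 ir) * h k) +
   ((j == 1 :> nat) && (i == k :> nat))%:R * (2 * dlogwarp i (p 0 ir) * h k) -
   ((i == j :> nat) && (k == 1 :> nat))%:R * (2 * dlogwarp i (p 0 ir) * h i * (h k / h 1%N)).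
  by rewrite [(i == j :> nat) && _]andbC; ring.
congr (_ + _ - _).
- by apply: E => ->.
- by apply: E => ->.
- rewrite andbC; apply: E => ->; rewrite divff ?mulr1 //.
  exact: (hn0 ir).
Qed.

Lemma is_derive_christoffel (i j k : 'I_4) r : 0 < r ->
  is_derive r 1 (fun x => christoffel (dlogwarp ^~ x) (ratio x) i j k)
    (dchristoffel (dlogwarp ^~ r) (d2logwarp ^~ r) (ratio r) i j k).
Proof.
move=> r0; have di := is_derive_dlogwarp i r0; have dj := is_derive_dlogwarp j r0.
have dq := is_derive_ratio i r0.
rewrite /christoffel /dchristoffel /ratio.
have dqi := is_deriveM dq di.
have [H1 H2] := is_deriveB (is_deriveD (is_deriveZ ((i == 1 :> nat) && (j == k :> nat))%:R dj)
  (is_deriveZ ((j == 1 :> nat) && (i == k :> nat))%:R di))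
  (is_deriveZ ((i == j :> nat) && (k == 1 :> nat))%:R dqi).
split; first exact: H1.
by apply: (etrans H2); rewrite /GRing.scale /=; ring.
Qed.

Lemma curv_frame_entry (i j k m : 'I_4) p : ucover p ->
  curv_frame nabla i j (frame k) p 0 m =
  sect (dlogwarp ^~ (p 0 ir)) (d2logwarp ^~ (p 0 ir)) i j *
  ((j == k)%:R * ratio (p 0 ir) j * (i == m)%:R
   - (i == k)%:R * ratio (p 0 ir) i * (j == m)%:R).
Proof.
move=> pc.
have pE (a b c d : 'I_4) : partial a (entry d (nabla (frame b) (frame c))) p =
    (a == 1 :> nat)%:R * dchristoffel (dlogwarp ^~ (p 0 ir)) (d2logwarp ^~ (p 0 ir)) (ratio (p 0 ir)) b c d.
  (* The Christoffel formula holds on the whole cover and not just at [p], so it may be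
     differentiated. *)
  rewrite -(partial_radial a (is_derive_christoffel b c d pc)).
  by apply: eq_partial => // q qc; exact: conn_frame_christoffel.
have r1 : ratio (p 0 ir) 1 = 1 by rewrite /ratio divff //; exact: (warp_neq0 ir).
rewrite -curv_christoffel // /curv_frame mxE [X in _ + X]mxE.
rewrite !(conn_conn_christoffel (lc_connection lc)) // !pE.
by congr (_ + _ - (_ + _)); apply: eq_bigr => l _; rewrite !conn_frame_christoffel.
Qed.

(** This is kappa_ij for i != j; with the sign convention in use, it is minus the sectional
    curvature of the coordinate plane. *)
Definition weight r (i j : nat) := sect (dlogwarp ^~ r) (d2logwarp ^~ r) i j / warp 1 r.

(** Torsion-freeness writes the bracket as a difference of covariant derivatives, whose smoothness
    is an axiom of the connection. *)
Lemma smooth_bracket U V : smooth U -> smooth V -> smooth (bracket U V).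
Proof.
move=> sU sV; apply: (eq_smooth (lc_torsion_free lc sU sV)).
by apply: smooth_vsub; exact: (conn_smooth (lc_connection lc)).
Qed.

Lemma curv_endo_biv_act U V Z p : smooth U -> smooth V -> smooth Z -> ucover p ->
  curv_endo nabla U V Z p =
  biv_act (weight (p 0 ir)) (warp ^~ (p 0 ir)) (U p) (V p) (Z p).
Proof.
move=> sU sV sZ pc.
rewrite (curv_endo_tensorial (lc_connection lc)) //; last exact: smooth_bracket.
have delta (x : 'I_4) (F : 'I_4 -> R) : \sum_k F k * (x == k)%:R = F x.
  rewrite (bigD1 x) //= big1 ?addr0 ?eqxx ?mulr1 // => k kx.
  by rewrite eq_sym (negbTE kx) mulr0.
apply/rowP => m; rewrite summxE !mxE.
pose q := ratio (p 0 ir).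
pose s := sect (dlogwarp ^~ (p 0 ir)) (d2logwarp ^~ (p 0 ir)).
transitivity (\sum_i \sum_j (U p 0 i * V p 0 j * s i j * q j * Z p 0 j * (m == i)%:R
    - U p 0 i * V p 0 j * s i j * q i * Z p 0 i * (m == j)%:R)).
  apply: eq_bigr => i _; rewrite summxE; apply: eq_bigr => j _; rewrite summxE.
  rewrite -(delta j (fun k => U p 0 i * V p 0 j * s i j * q j * Z p 0 k * (m == i)%:R)).
  rewrite -(delta i (fun k => U p 0 i * V p 0 j * s i j * q i * Z p 0 k * (m == j)%:R)).
  rewrite -sumrB; apply: eq_bigr => k _.
  rewrite mxE curv_frame_entry // -/(s i j) -/q [m == i]eq_sym [m == j]eq_sym; ring.
(* Exchanging the sums in the first part only makes the surviving index play the role of [j] in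
   both; symmetry of [sect] then merges them into one bivector coefficient. *)
under eq_bigr do rewrite sumrB; rewrite sumrB exchange_big /=.
under eq_bigr do rewrite delta.
under [X in _ - X]eq_bigr do rewrite delta.
rewrite -sumrB; apply: eq_bigr => j _.
rewrite /weight -/(s m j) (_ : s j m = s m j); last exact: sectC.
rewrite /q /ratio; field; exact: (warp_neq0 ir).
Qed.

Lemma curv_tensor_biv_form (W : 'I_4 -> vfield R) p :
  (forall i, smooth (W i)) -> ucover p ->
  curv_tensor (metric_of f) nabla W p =
  biv_form (weight (p 0 ir)) (warp ^~ (p 0 ir)) (W it p) (W ir p) (W iz p) (W iphi p).
Proof.
move=> sW pc; have [e1 e2 e3] : [/\ 1 = ir, 2 = iz & 3 = iphi] by split; exact: val_inj.
have e0 : 0 = it by exact: val_inj.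
by rewrite /curv_tensor innerE e3 e2 e1 e0 curv_endo_biv_act.
Qed.

(** Passage from fields to vectors at [p], shared by both sides of the theorem. The modified slots
    must be smooth fields, because the curvature formula is available only for those. *)
Lemma endo_act_biv_form (E : vfield R -> vfield R) (e : 'rV[R]_4 -> 'rV[R]_4)
    (Z : 'I_4 -> vfield R) p :
  (forall i, smooth (Z i)) -> (forall i, smooth (E (Z i))) -> ucover p ->
  (forall i, E (Z i) p = e (Z i p)) ->
  let T := biv_form (weight (p 0 ir)) (warp ^~ (p 0 ir)) in
  let z i := Z i p in
  endo_act E (curv_tensor (metric_of f) nabla) Z p =
  - (T (e (z it)) (z ir) (z iz) (z iphi) + T (z it) (e (z ir)) (z iz) (z iphi)
     + T (z it) (z ir) (e (z iz)) (z iphi) + T (z it) (z ir) (z iz) (e (z iphi))).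
Proof.
move=> sZ sE pc Ee T z; rewrite /endo_act sum4; congr (- _).
have sW i j : smooth (if j == i then E (Z j) else Z j) by case: ifP.
rewrite !(curv_tensor_biv_form (sW _)) //=.
by rewrite !Ee.
Qed.

End Metric.

Theorem lemma3p2 (R : realType) (f : R -> R)
  (f_smooth : forall (n : nat) (r : R), 0 < r -> derivable (f^`(n)%classic) r 1)
  (f_ode : forall r : R, 0 < r ->
     r * f^`(2)%classic r + r * (f^`()%classic r) ^+ 2 - f^`()%classic r = 0)
  (nabla : vfield R -> vfield R -> vfield R)
  (nabla_lc : levi_civita (metric_of f) nabla)
  (Z : 'I_4 -> vfield R) (U V : vfield R)
  (Z_smooth : forall i, smooth (Z i)) (U_smooth : smooth U) (V_smooth : smooth V)
  (p : coords R) (p_cover : ucover p) :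
  let g := metric_of f in
  let r := p 0 ir in
  let L := expR (- (2 * f r)) / r * (f^`()%classic r - r * (f^`()%classic r) ^+ 2) in
  tensor_dot (curv_endo nabla) (curv_tensor g nabla) Z U V p
  = L * tachibana (inner g) (curv_tensor g nabla) Z U V p.
Proof.
move=> g r L; set h := warp f ^~ r.
set P := weight f r 0 2; set Q := weight f r 1 3.
have r0 : r != 0 by rewrite gt_eqF.
have ode : f^`(2)%classic r = f^`()%classic r / r - (f^`()%classic r) ^+ 2.
  have {f_ode} := f_ode r p_cover; move: (f^`(2)%classic r) (f^`()%classic r) => d2 d1 E.
  apply: (mulfI r0); rewrite -[LHS]subr0 -E; field; exact: r0.
have h0 : expR (2 * f r) != 0 by rewrite gt_eqF ?expR_gt0.
(* Up to the factor e^(-2f), the pairs {t, phi} and {z, phi} have weight f' (1/r - f'), which is the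
   origin of [L]; {t, r} and {z, r} have weight f'', which [ode] turns into the same value. *)
have wE (i j : 'I_4) : i != j -> weight f r i j = block_weights L P Q i j.
  rewrite /P /Q /weight /sect /dlogwarp /d2logwarp /L /warp expRN ode.
  case: i => [[|[|[|[|i]]]] ?] //; case: j => [[|[|[|[|j]]]] ?] // _ /=;
  by field; rewrite ?r0 ?h0.
have wS i : smooth (wedge_endo (inner g) U V (Z i)) by exact: smooth_wedge.
have cS i : smooth (curv_endo nabla U V (Z i)).
  have sN X Y : smooth X -> smooth Y -> smooth (nabla X Y).
    exact: (conn_smooth (lc_connection nabla_lc)).
  apply: smooth_vsub; first by apply: sN => //; exact: (smooth_bracket nabla_lc).
  by apply: smooth_vsub; apply: (sN) => //; exact: sN.
rewrite /tensor_dot /tachibana.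
rewrite (endo_act_biv_form f_smooth nabla_lc (e := biv_act (weight f r) h (U p) (V p))) //; last first.
  by move=> i; exact: curv_endo_biv_act.
rewrite (endo_act_biv_form f_smooth nabla_lc (e := biv_act (fun _ _ => 1) h (U p) (V p))) //; last first.
  by move=> i; exact: wedge_biv_act.
(* The block weights replace [weight] both in the acting endomorphism and in the tensor acted upon,
   as [biv_form_block] requires. *)
have act u v z := eq_biv_act h u v z wE.
by rewrite mulrN /biv_form !act -/(biv_form _ _ _ _ _ _) biv_form_block.
Qed.
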